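(* Let $R$ be a maximal subring of a ring $T$ and $I$ be a nonzero ideal of $T$ with $R\cap I=0$. Then the following hold: (1) If either $R$ or $T$ is a one-sided Artinian ring, then $J(R)=J(T)\cap R$ and $Nil^*(R)=Nil^*(T)\cap R$. (2) If $R$ is a left Artinian ring, then $Soc({}_RI)=I$. In particular, ${}_RT$ is Artinian if and only if ${}_RI$ is finitely generated.
   Context: All rings are associative and unital (not necessarily commutative), and subrings contain the identity of the big ring; ''ideal'' means two-sided ideal. A maximal subring $R$ of $T$ is a proper subring with no subring strictly between $R$ and $T$. One-sided Artinian means left Artinian or right Artinian. $J$ is the Jacobson radical, $Nil^*$ the upper nilradical (the largest nil ideal), and $Soc({}_RM)$ the socle of a left $R$-module $M$. *)

(* Defs.v *)
From HB Require Import structures.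
From mathcomp Require Import all_boot all_order all_algebra.
From mathcomp Require Import all_classical.

Set Implicit Arguments.
Unset Strict Implicit.
Unset Printing Implicit Defensive.

Import GRing.Theory.
Local Open Scope classical_set_scope.
Local Open Scope ring_scope.

(* Noncommutative rings with 1 are [pzRingType]; the zero ring is not excluded,
   but a ring with a proper unital subring is never zero. *)

(* Modules are always considered as submodules [N : set M] of an ambient left
   module [M]; a whole module is [setT]. *)
Section Modules.
Variables (A : pzRingType) (M : lmodType A).
Implicit Types (K L N : set M).

Definition submodule N : Prop := submod_closed (mem N).

Definition artinian_module N : Prop :=
  forall F : nat -> set M,
    (forall n, submodule (F n) /\ F n `<=` N) ->
    (forall n, F n.+1 `<=` F n) ->
  exists n0, forall n, (n0 <= n)%N -> F n = F n0.

Definition simple_module L : Prop :=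
  [/\ submodule L, L <> [set 0] &
      forall K, submodule K -> K `<=` L -> K = [set 0] \/ K = L].

Definition module_span (X : set M) : set M := smallest submodule X.

Definition finitely_generated N : Prop :=
  exists s : seq M, N = module_span [set` s].

Definition socle N : set M :=
  module_span (\bigcup_(L in [set L | simple_module L /\ L `<=` N]) L).

End Modules.

Section Rings.
Variable A : pzRingType.
Implicit Types (I L : set A).

Definition left_ideal L : Prop := submodule (L : set A^o).

Definition ideal I : Prop :=
  left_ideal I /\ (forall x a, I x -> I (x * a)).

Definition left_artinian : Prop := artinian_module [set: A^o].

Definition maximal_left_ideal L : Prop :=
  [/\ left_ideal L, L <> setT &
      forall K : set A, left_ideal K -> L `<=` K -> K = L \/ K = setT].

Definition jacobson_radical : set A :=
  \bigcap_(L in maximal_left_ideal) L.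

Definition nil_ideal I : Prop :=
  ideal I /\ (forall x, I x -> exists n, x ^+ n = 0).

(* The union of all nil ideals; it is itself a nil ideal, hence the largest one,
   see [upper_nilradical_largest]. *)
Definition upper_nilradical : set A := \bigcup_(I in nil_ideal) I.

End Rings.

Arguments jacobson_radical : clear implicits.
Arguments upper_nilradical : clear implicits.

Definition right_artinian (A : pzRingType) : Prop := left_artinian A^c.

Definition one_sided_artinian (A : pzRingType) : Prop :=
  left_artinian A \/ right_artinian A.

Definition maximal_subring (T : pzRingType) (S : {pred T}) : Prop :=
  [/\ subring_closed S, ~ (S =i predT) &
      forall Q : {pred T}, subring_closed Q -> {subset S <= Q} ->
        Q =i S \/ Q =i predT].

(* [restrict_scalars R] is the ring [T] seen as a left module over its
   subring [R]. *)
Definition restrict_scalars (T : pzRingType) (S : {pred T}) (R : subPzRingType S) : Type :=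
  T.

Section RestrictScalars.
Variables (T : pzRingType) (S : {pred T}) (R : subPzRingType S).

HB.instance Definition _ := GRing.Zmodule.copy (restrict_scalars R) T.

Definition restrict_scale (a : R) (x : restrict_scalars R) :
    restrict_scalars R := (\val a : T) * (x : T).

Fact restrict_scaleA a b x :
  restrict_scale a (restrict_scale b x) = restrict_scale (a * b) x.
Proof. by rewrite /restrict_scale rmorphM mulrA. Qed.

Fact restrict_scale1 : left_id 1 restrict_scale.
Proof. by move=> x; rewrite /restrict_scale rmorph1 mul1r. Qed.

Fact restrict_scaleDr : right_distributive restrict_scale +%R.
Proof. by move=> a x y; rewrite /restrict_scale mulrDr. Qed.

Fact restrict_scaleDl x : {morph restrict_scale^~ x : a b / a + b}.
Proof. by move=> a b; rewrite /restrict_scale rmorphD mulrDl. Qed.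

HB.instance Definition _ :=
  GRing.Zmodule_isLmodule.Build R (restrict_scalars R)
    restrict_scaleA restrict_scale1 restrict_scaleDr restrict_scaleDl.

Lemma restrict_scaleE (a : R) (x : restrict_scalars R) :
  a *: x = (\val a : T) * (x : T).
Proof. by []. Qed.

End RestrictScalars.

Section UpperNilradical.
Variable A : pzRingType.

Lemma ideal0 (I : set A) : ideal I -> I 0.
Proof. by move=> [[+ _] _]; rewrite inE. Qed.

Lemma idealD (I : set A) x y : ideal I -> I x -> I y -> I (x + y).
Proof.
move=> [[_ linI] _] Ix Iy; have := linI 1 x y; rewrite !inE /= scale1r.
by apply.
Qed.

Lemma idealMl (I : set A) a x : ideal I -> I x -> I (a * x).
Proof.
move=> idI Ix; have [[_ linI] _] := idI; have := linI a x 0.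
by rewrite !inE /= addr0; apply => //; apply: ideal0.
Qed.

Lemma ideal_add (I J : set A) : ideal I -> ideal J ->
  ideal [set z | exists x y, [/\ I x, J y & z = x + y]].
Proof.
move=> idI idJ; split; first split.
- by rewrite inE; exists 0, 0; split; rewrite ?addr0 //; apply: ideal0.
- move=> a u v; rewrite !inE => -[x [y [Ix Jy ->]]] [x' [y' [Ix' Jy' ->]]].
  exists (a * x + x'), (a * y + y'); split.
  + by apply: idealD => //; apply: idealMl.
  + by apply: idealD => //; apply: idealMl.
  + by rewrite /= [a *: _]mulrDr addrACA.
- move=> z a [x [y [Ix Jy ->]]]; exists (x * a), (y * a).
  by split; [case: idI => _; apply|case: idJ => _; apply|rewrite mulrDl].
Qed.

Lemma nil_ideal_add (I J : set A) : nil_ideal I -> nil_ideal J ->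
  nil_ideal [set z | exists x y, [/\ I x, J y & z = x + y]].
Proof.
move=> [idI nilI] [idJ nilJ]; split; first exact: ideal_add.
move=> _ [x [y [Ix Jy ->]]]; have [n xn0] := nilI _ Ix.
have powJ k : J ((x + y) ^+ k - x ^+ k).
  elim: k => [|k IHk]; first by rewrite !expr0 subrr; apply: ideal0.
  rewrite !exprS (_ : _ - _ = (x + y) * ((x + y) ^+ k - x ^+ k) + y * x ^+ k).
    by apply: idealD => //; [apply: idealMl|case: idJ => _; apply].
  by rewrite mulrBr [X in _ - X + _]mulrDl opprD !addrA subrK.
have [m xym0] := nilJ _ (powJ n).
by exists (n * m)%N; rewrite exprM -[(x + y) ^+ n]subr0 -[X in _ - X]xn0.
Qed.

Lemma upper_nilradical_largest :
  nil_ideal (upper_nilradical A) /\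
  (forall I : set A, nil_ideal I -> I `<=` upper_nilradical A).
Proof.
split; last by move=> I nilI x Ix; exists I.
split; first split; first split.
- rewrite inE; exists [set 0] => //; split; first split; first split.
  + by rewrite inE.
  + by move=> a u v; rewrite !inE => -> ->; rewrite scaler0 addr0.
  + by move=> x a ->; rewrite /= mul0r.
  + by move=> x ->; exists 1%N; rewrite expr1.
- move=> a u v; rewrite !inE => -[I nilI Iu] [J nilJ Jv].
  exists [set z | exists x y, [/\ I x, J y & z = x + y]].
    exact: nil_ideal_add.
  by exists (a * u), v; split=> //; apply: idealMl => //; case: nilI.
- by move=> x a [I nilI Ix]; exists I => //; case: nilI => -[_ +] _; apply.
- by move=> x [I [_ nilI] /nilI].
Qed.

End UpperNilradical.

(* Main.v *)
(** Maximality of [S] gives [T = S + I] as a direct sum, so [R] is a quotient of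
    [T], and it also makes [I] minimal among the [S]-subbimodules of [I] that
    are closed under multiplication. If [R] is one-sided Artinian, then [J(R)] is
    nilpotent, so the bimodule [J(R) I] cannot be all of [I]; hence
    [J(R) I = I J(R) = 0] and [J(R)] is a nilpotent ideal of [T], which yields
    the nontrivial inclusions of (1). For (2), [I] is a module over [R / J(R)];
    an [R]-module killed by [J(R)] is semisimple because, for a minimal left
    ideal [L] acting nontrivially on [z] and [X] a maximal left ideal not
    containing [L], every left ideal [B] containing [L] is [L + (B :&: X)], and
    [B] can be lowered to [B :&: X]. *)

Require Import Defs.
From HB Require Import structures.
From mathcomp Require Import all_boot all_order all_algebra.
From mathcomp Require Import all_classical.

Set Implicit Arguments.
Unset Strict Implicit.
Unset Printing Implicit Defensive.

Import GRing.Theory.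
Local Open Scope classical_set_scope.
Local Open Scope ring_scope.

(** * Submodules, spans and chain conditions *)

Lemma submoduleP (A : pzRingType) (M : lmodType A) (N : set M) :
  submodule N <-> N 0 /\ forall a u v, N u -> N v -> N (a *: u + v).
Proof.
split=> [[N0 linN]|[N0 linN]]; split.
- by rewrite inE in N0.
- by move=> a u v Nu Nv; have := linN a u v; rewrite !inE; apply.
- by rewrite inE.
- by move=> a u v; rewrite !inE; apply: linN.
Qed.

Lemma left_idealP (A : pzRingType) (L : set A) :
  left_ideal L <-> L 0 /\ forall a u v, L u -> L v -> L (a * u + v).
Proof. exact: (@submoduleP A A^o). Qed.

Section ModuleTheory.
Context {A : pzRingType} {M : lmodType A}.
Implicit Types (K L N P V : set M).

Lemma submodule0 N : submodule N -> N 0.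
Proof. by move=> /submoduleP[]. Qed.

Lemma submoduleD N u v : submodule N -> N u -> N v -> N (u + v).
Proof. by move=> /submoduleP[_ lN] Nu Nv; rewrite -[u]scale1r; apply: lN. Qed.

Lemma submoduleZ N a u : submodule N -> N u -> N (a *: u).
Proof.
by move=> /submoduleP[N0 lN] Nu; rewrite -[X in N X]addr0; apply: lN.
Qed.

Lemma submoduleB N u v : submodule N -> N u -> N v -> N (u - v).
Proof.
by move=> sN Nu Nv; rewrite -scaleN1r; apply: submoduleD (submoduleZ _ sN _).
Qed.

Lemma submodule_setT : submodule [set: M].
Proof. by apply/submoduleP. Qed.

Lemma submodule_set0 : submodule [set (0 : M)].
Proof. by apply/submoduleP; split=> // a _ _ -> ->; rewrite scaler0 addr0. Qed.

Lemma submoduleI N K : submodule N -> submodule K -> submodule (N `&` K).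
Proof.
move=> /submoduleP[N0 lN] /submoduleP[K0 lK]; apply/submoduleP; split=> //.
by move=> a u v [Nu Ku] [Nv Kv]; split; [apply: lN|apply: lK].
Qed.

Definition submodule_add N K : set M :=
  [set z | exists u v, [/\ N u, K v & z = u + v]].

Lemma submodule_addP N K :
  submodule N -> submodule K -> submodule (submodule_add N K).
Proof.
move=> sN sK; apply/submoduleP; split.
  by exists 0, 0; split; rewrite ?addr0 //; apply: submodule0.
move=> a _ _ [u [v [Nu Kv ->]]] [u' [v' [Nu' Kv' ->]]].
exists (a *: u + u'), (a *: v + v'); split; last by rewrite scalerDr addrACA.
- by apply: submoduleD => //; apply: submoduleZ.
- by apply: submoduleD => //; apply: submoduleZ.
Qed.

Lemma sub_submodule_addl N K : submodule K -> N `<=` submodule_add N K.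
Proof. by move=> /submodule0 K0 u Nu; exists u, 0; rewrite addr0. Qed.

Lemma sub_submodule_addr N K : submodule N -> K `<=` submodule_add N K.
Proof. by move=> /submodule0 N0 u Ku; exists 0, u; rewrite add0r. Qed.

Definition ideal_smul (L : set A) (x : M) : set M := [set a *: x | a in L].

Lemma submodule_smul (L : set A) x : left_ideal L -> submodule (ideal_smul L x).
Proof.
move=> /left_idealP[L0 lL]; apply/submoduleP; split.
  by exists 0; rewrite ?scale0r.
move=> a _ _ [b Lb <-] [c Lc <-]; exists (a * b + c); first exact: lL.
by rewrite scalerDl scalerA.
Qed.

Lemma left_ideal_conductor N x :
  submodule N -> left_ideal [set a : A | N (a *: x)].
Proof.
move=> /submoduleP[N0 lN]; apply/left_idealP; split=> /=.
  by rewrite scale0r.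
move=> a u v Nu Nv; rewrite scalerDl -scalerA.
exact: lN.
Qed.

Lemma submodule_span (X : set M) : submodule (module_span X).
Proof.
apply/submoduleP; split=> [N [sN _]|a u v Xu Xv N [sN XN]].
  exact: submodule0.
by apply: (submoduleD sN); [apply: (submoduleZ _ sN); apply: Xu|apply: Xv].
Qed.

Lemma mem_span (X : set M) : X `<=` module_span X.
Proof. exact: sub_gen_smallest. Qed.

Lemma span_sub (X : set M) N : submodule N -> X `<=` N -> module_span X `<=` N.
Proof. exact: smallest_sub. Qed.

Lemma span_cons x (s : seq M) :
  module_span [set` x :: s] =
    submodule_add (ideal_smul setT x) (module_span [set` s]).
Proof.
have sT : left_ideal [set: A] by apply/left_idealP.
have sX := submodule_smul x sT; have sS := submodule_span [set` s].
apply/seteqP; split.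
  apply: span_sub; first exact: submodule_addP.
  move=> y; rewrite /= inE => /orP[/eqP->|ys].
    by apply: sub_submodule_addl => //; exists 1; rewrite ?scale1r.
  by apply: sub_submodule_addr => //; apply: mem_span.
have sSx := submodule_span [set` x :: s].
move=> _ [_ [v [[a _ <-] sv ->]]]; apply: (submoduleD sSx).
  by apply: (submoduleZ _ sSx); apply: mem_span; rewrite /= mem_head.
by move: v sv; apply: span_sub => // y ys; apply: mem_span;
  rewrite /= inE ys orbT.
Qed.

(** In the regular module with [y = 1] this yields maximal left ideals; with [N = 0] and [y <> 0] it
    yields a [K] such that every nonzero submodule of [M / K] contains the class of [y]. *)
Lemma maximal_submodule_avoiding N y : submodule N -> ~ N y ->
  exists K, [/\ submodule K, N `<=` K, ~ K y &
    forall L, submodule L -> K `<=` L -> ~ L y -> L `<=` K].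
Proof.
move=> sN Ny.
(* Zorn's lemma also ranges over the empty chain, hence the union with [N]. *)
pose P := [set X | submodule (X `|` N) /\ ~ (X `|` N) y].
have [F FP totF|X [[sX Xy] maxX]] := @Zorn_bigcup M P; last first.
  exists (X `|` N); split=> // L sL XL Ly.
  have XL' : X `<=` L by move=> z Xz; apply: XL; left.
  have PL : P L.
    have LN : L `|` N = L.
      by apply/seteqP; split=> z; [case=> // Nz; apply: XL; right|left].
    by split; rewrite LN.
  have [LX|LX] := pselect (L `<=` X); first by move=> z /LX; left.
  by have [] := maxX L.
have up X : F X -> X `|` N `<=` \bigcup_(Z in F) Z `|` N.
  by move=> FX z [Xz|Nz]; [left; exists X|right].
split; last by move=> [[X FX Xy]|//]; have [_] := FP _ FX; apply; left.
apply/submoduleP; split; first by right; apply: submodule0.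
have lin X a u v : F X -> (X `|` N) u -> (X `|` N) v ->
    (\bigcup_(Z in F) Z `|` N) (a *: u + v).
  move=> FX Xu Xv; apply: (up X) => //; have [/submoduleP[_ lX] _] := FP _ FX.
  exact: lX.
move=> a u v [[X FX Xu]|Nu] [[Y FY Yv]|Nv].
- have [XY|YX] := totF _ _ FX FY.
  + by apply: (lin Y) => //; left => //; apply: XY.
  + by apply: (lin X) => //; left => //; apply: YX.
- by apply: (lin X) => //; [left|right].
- by apply: (lin Y) => //; [right|left].
- by right; move/submoduleP: sN => [_]; apply.
Qed.

(** Dependent choice: without a minimal member, passing repeatedly to a strictly smaller one gives a
    descending chain that never stabilizes. *)
Lemma artinian_minimal N (P : set (set M)) : artinian_module N ->
    (forall K, P K -> submodule K /\ K `<=` N) -> (exists K, P K) ->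
  exists K, P K /\ forall L, P L -> L `<=` K -> L = K.
Proof.
move=> artN PN [K0 PK0]; apply: contrapT => noMin.
have step (K : {K | P K}) :
    {L : {L | P L} | sval L `<=` sval K /\ sval L <> sval K}.
  apply: cid; apply: contrapT => noL; apply: noMin.
  exists (sval K); split; first exact: (svalP K).
  by move=> L PL LK; apply: contrapT => LneK; apply: noL; exists (exist _ L PL).
pose F n : {K | P K} :=
  iter n (fun K : {K | P K} => sval (step K)) (exist _ K0 PK0).
have [||n0 Fn0] := artN (fun n => sval (F n)).
- by move=> n; apply: PN; apply: svalP.
- by move=> n; apply: (svalP (step (F n))).1.
- by have [_] := svalP (step (F n0)); apply; apply: (Fn0 n0.+1).
Qed.

Lemma artinian_sub K N : K `<=` N -> artinian_module N -> artinian_module K.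
Proof.
move=> KN artN F FK decF; apply: artN => // n; have [sF FnK] := FK n.
by split=> // x /FnK /KN.
Qed.

(** Induction on the generators, as for an extension: a descending chain is governed by its trace on
    the span of [s] and by the left ideals of coefficients of [x] occurring modulo that span, and
    both become stationary. *)
Lemma artinian_span (s : seq M) :
  left_artinian A -> artinian_module (module_span [set` s]).
Proof.
move=> artA; elim: s => [|x s IHs] F sF decF.
  exists 0%N => n _; have F0 k : F k = [set 0].
    have [sFk Fk] := sF k; apply/seteqP; split=> [y /Fk|_ ->].
      by apply: span_sub => //; apply: submodule_set0.
    exact: submodule0.
  by rewrite !F0.
have sS := submodule_span [set` s].
have mono m n : (m <= n)%N -> F n `<=` F m.
  move=> /subnK <-; elim: (n - m)%N => // k IHk y; rewrite addSn => /decF.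
  exact: IHk.
have [||n1 G1] := IHs (fun n => F n `&` module_span [set` s]).
- move=> n; split; last by move=> y [].
  by apply: submoduleI => //; case: (sF n).
- by move=> n y [/decF Fy sy].
have [||n2 H2] :=
    artA (fun n => [set a | submodule_add (F n) (module_span [set` s]) (a *: x)]).
- move=> n; split=> //; apply: left_ideal_conductor; apply: submodule_addP => //.
  by case: (sF n).
- move=> n a /= [u [v [Fu sv ->]]]; exists u, v; split=> //; exact: decF.
exists (maxn n1 n2) => n len; apply/seteqP; split; first exact: mono.
move=> z Fz; have := (sF _).2 _ Fz; rewrite span_cons.
move=> [_ [v [[a _ <-] sv zE]]].
have : [set a | submodule_add (F n2) (module_span [set` s]) (a *: x)] a.
  exists z, (- v); split; last by rewrite zE addrK.
    by apply: mono Fz; apply: leq_maxr.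
  by rewrite -[- v]add0r; apply: (submoduleB sS) => //; apply: submodule0.
rewrite -(H2 n) ?(leq_trans (leq_maxr _ _) len) // => -[u [w [Fu sw axE]]].
have sFm := (sF (maxn n1 n2)).1; have sFn := (sF n).1.
(* Both [z] and [u] equal [a *: x] up to the span of [s], so their difference [w + v] lies in that
   span, where the chain is already stationary. *)
have : (F n1 `&` module_span [set` s]) (w + v).
  split; last exact: (submoduleD sS).
  have -> : w + v = z - u by rewrite zE axE [RHS]addrC -addrA addKr.
  apply: (mono n1 (maxn n1 n2)); first exact: leq_maxl.
  by apply: submoduleB => //; apply: mono Fu.
rewrite -(G1 n) ?(leq_trans (leq_maxl _ _) len) // => -[Fwv _].
by rewrite zE axE -addrA; apply: submoduleD.
Qed.

End ModuleTheory.

Lemma left_artinian_minimal (A : pzRingType) (P : set (set A)) :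
    left_artinian A -> (forall L, P L -> left_ideal L) -> (exists L, P L) ->
  exists L, P L /\ forall K, P K -> K `<=` L -> K = L.
Proof.
by move=> artA PL exP; apply: (artinian_minimal artA) => // L /PL.
Qed.

Section Semisimple.
Context {A : pzRingType} {M : lmodType A}.
Hypothesis artA : left_artinian A.
Implicit Types (K N V : set M) (L : set A).

(* With [K = 0] and [V] the socle this says that modules killed by the radical
   are semisimple; a general [K] gives the same statement in [M / K] without
   forming the quotient. *)
Lemma semisimple_induction K V (z : M) :
    submodule V -> K `<=` V ->
    (forall a, jacobson_radical A a -> K (a *: z)) ->
    (forall L, left_ideal L -> ~ (ideal_smul L z `<=` K) ->
      (forall L', left_ideal L' -> L' `<=` L -> ~ (ideal_smul L' z `<=` K) ->
        L' = L) ->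
      ideal_smul L z `<=` V) ->
  V z.
Proof.
move=> sV KV JzK minV.
(* [P] records that [z] is congruent modulo [V] to an element of [B z]; a minimal such [B] turns out
   to have [B z] inside [V], so that [z] lies in [V]. *)
pose P := [set B : set A | left_ideal B /\ exists2 b, B b & V (z - b *: z)].
have [||B [[idB [b Bb Vb]] minB]] := left_artinian_minimal (P := P) artA.
- by move=> B [].
- exists setT; split; first exact: submodule_setT.
  by exists 1 => //; rewrite scale1r subrr; apply: submodule0.
have [BV|nBV] := pselect (ideal_smul B z `<=` V).
  by rewrite -(subrK (b *: z) z); apply: submoduleD => //; apply: BV; exists b.
pose Q := [set L : set A |
  [/\ left_ideal L, L `<=` B & ~ (ideal_smul L z `<=` K)]].
have [||L [[idL LB LK] minL]] := left_artinian_minimal (P := Q) artA.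
- by move=> L [].
- by exists B; split=> // BK; apply: nBV => y /BK /KV.
have LzV : ideal_smul L z `<=` V.
  by apply: minV => // L' idL' L'L L'K; apply: minL => //; split=> // y /L'L /LB.
have [m Lm Kmz] : exists2 m, L m & ~ K (m *: z).
  apply: contrapT => noM; apply: LK => _ [m Lm <-].
  by apply: contrapT => Km; apply: noM; exists m.
have [X maxX Xm] : exists2 X, maximal_left_ideal X & ~ X m.
  apply: contrapT => noX; apply: Kmz; apply: JzK => X maxX.
  by apply: contrapT => Xm; apply: noX; exists X.
have [idX XneT maxX'] := maxX.
have [LXX|LXT] : submodule_add (L : set A^o) X = X \/
    submodule_add (L : set A^o) X = setT.
- apply: maxX'; first exact: submodule_addP.
  exact: (@sub_submodule_addr A A^o).
- by case: Xm; rewrite -LXX; apply: (@sub_submodule_addl A A^o).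
have [l [x [Ll Xx bE]]] : exists l x : A, [/\ L l, X x & b = l + x].
  by have : submodule_add (L : set A^o) X b by rewrite LXT.
(* Replacing [b] by [x = b - l] changes [b *: z] only by [l *: z], which lies in [V], so [B :&: X]
   is again in [P]; yet it misses [m], against the minimality of [B]. *)
suff BX : B `&` X = B by case: Xm; have : B m := LB _ Lm; rewrite -BX => -[].
apply: minB; last by move=> y [].
split; first exact: submoduleI.
exists x; first split => //.
  have -> : x = b - l by rewrite bE addrC addKr.
  by apply: (submoduleB idB Bb); apply: LB.
have -> : z - x *: z = (z - b *: z) + l *: z.
  by rewrite bE scalerDl opprD addrA addrAC subrK.
by apply: submoduleD => //; apply: LzV; exists l.
Qed.

(** If [L] is minimal among the left ideals not killing [z], then [L z] is simple: a submodule [K]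
    of it is [L' z], where [L'] is the part of [L] sending [z] into [K], and [L'] either kills [z]
    or equals [L]. *)
Lemma socle_radical_annihilated N : submodule N ->
  (forall a x, jacobson_radical A a -> N x -> a *: x = 0) -> socle N = N.
Proof.
move=> sN JN; apply/seteqP; split.
  by apply: span_sub => // x [L [_ LN] /LN].
move=> z Nz; apply: (semisimple_induction (K := [set 0])).
- exact: submodule_span.
- by move=> _ ->; apply: submodule0; apply: submodule_span.
- by move=> a Ja; apply: JN.
move=> L idL Lz0 minL; have sLz := submodule_smul z idL.
move=> y Ly; apply: mem_span; exists (ideal_smul L z) => //; split; last first.
  by move=> _ [a _ <-]; apply: submoduleZ.
split=> //; first by move=> Lz; apply: Lz0; rewrite Lz.
move=> K sK KLz; pose L' := L `&` [set a | K (a *: z)].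
have L'zE : ideal_smul L' z = K.
  apply/seteqP; split; first by move=> _ [a [_ Ka] <-].
  by move=> u Ku; have [a La au] := KLz _ Ku; exists a => //; split; rewrite //= au.
have [L'0|L'0] := pselect (ideal_smul L' z `<=` [set 0]).
  left; rewrite -L'zE; apply/seteqP; split=> // _ ->; rewrite L'zE.
  exact: submodule0.
right; rewrite -L'zE (minL L') //; last by move=> a [].
by apply: (@submoduleI _ A^o) => //; apply: left_ideal_conductor.
Qed.

(** [K] is a minimal remainder after adjoining finitely many generators. A nonzero [y] in [K] would
    allow a smaller one: adjoin [y] and pass to [K :&: K'], with [K'] maximal avoiding [y]. *)
Lemma finitely_generated_radical_annihilated N : submodule N ->
    (forall a x, jacobson_radical A a -> N x -> a *: x = 0) ->
  artinian_module N -> finitely_generated N.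
Proof.
move=> sN JN artN.
pose P := [set K | [/\ submodule K, K `<=` N &
  exists2 s : seq M, [set` s] `<=` N &
    N `<=` submodule_add (module_span [set` s]) K]].
have [||K [[sK KN [s sN' NsK]] minK]] := artinian_minimal (P := P) artN.
- by move=> K [].
- exists N; split=> //; exists [::] => //.
  by apply: sub_submodule_addr; apply: submodule_span.
have [K0|/existsNP[y /not_implyP[Ky y0]]] := pselect (K `<=` [set 0]).
  exists s; apply/seteqP; split; last exact: span_sub.
  by move=> x /NsK[u [v [su /K0 -> ->]]]; rewrite addr0.
have [K' [sK' _ K'y maxK']] := maximal_submodule_avoiding submodule_set0 y0.
suff KK' : K `&` K' = K by case: K'y; move: Ky; rewrite -KK' => -[].
apply: minK; last by move=> x [].
have idT : left_ideal [set: A] by exact: submodule_setT.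
split; [exact: submoduleI|by move=> x [/KN]|].
exists (y :: s).
  by move=> x; rewrite /= inE => /orP[/eqP->|/sN' //]; apply: KN.
have sRy := submodule_smul y idT.
have sS := submodule_span [set` s].
(* As [y] lies in [K], the modular law turns this inclusion into [K = A y + (K :&: K')]. The
   inclusion itself is the semisimplicity argument carried out modulo [K']. *)
suff KRy : K `<=` submodule_add (ideal_smul setT y) K'.
  move=> x /NsK[u [v [su Kv ->]]]; have [w [k' [Rw K'k' vE]]] := KRy v Kv.
  exists (w + u), k'; split; last by rewrite vE addrCA addrA.
    by rewrite span_cons; exists w, u.
  split=> //; have -> : k' = v - w by rewrite vE addrC addKr.
  by apply: submoduleB => //; case: Rw => a _ <-; apply: submoduleZ.
have sV := submodule_addP sRy sK'.
move=> z Kz; apply: (semisimple_induction (K := K')) => //.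
- exact: sub_submodule_addr.
- by move=> a Ja; rewrite (JN _ z) //; [apply: submodule0|apply: KN].
move=> L idL LzK' minL.
have sLz := submodule_smul z idL.
(* [K'] is maximal avoiding [y], so [y] is congruent to some [m *: z] modulo
   [K']; minimality then makes [L] the principal left ideal [A m]. *)
have [k [_ [K'k [m Lm <-] yE]]] : submodule_add K' (ideal_smul L z) y.
  apply: contrapT => ny; apply: LzK' => u Lu.
  apply: (maxK' _ _ _ ny); first exact: submodule_addP.
    exact: sub_submodule_addl.
  exact: sub_submodule_addr.
have LE : [set a * m | a in setT] = L.
  apply: minL; first exact: (@submodule_smul A A^o).
    by move=> _ [a _ <-]; apply: (submoduleZ _ idL).
  move=> sub; apply: K'y; rewrite yE; apply: submoduleD => //; apply: sub.
  by exists m => //; exists 1; rewrite ?mul1r.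
rewrite -LE => _ [_ [a _ <-] <-].
rewrite -scalerA.
have -> : m *: z = y - k by rewrite yE addrC addKr.
apply: submoduleZ => //; exists y, (- k); split=> //.
  by exists 1; rewrite ?scale1r.
by rewrite -[- k]add0r; apply: submoduleB => //; apply: submodule0.
Qed.

End Semisimple.

(** * The Jacobson radical: quasiregularity, nil ideals and nilpotence *)

Section JacobsonRadical.
Context {A : pzRingType}.
Implicit Types (I L N : set A).

Lemma ideal_jacobson_radical : ideal (jacobson_radical A).
Proof.
split=> [|x a Jx L [idL LneT maxL]].
  apply/left_idealP; split=> [L [idL _ _]|a u v Ju Jv L maxL].
    exact: (submodule0 idL).
  have [idL _ _] := maxL; have [_ linL] := (left_idealP L).1 idL.
  by apply: linL; [apply: Ju|apply: Jv].
have [La|La] := pselect (L a).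
  by apply: (submoduleZ x idL La).
(* Otherwise the conductor [(L : a)] is again a maximal left ideal. *)
pose L' := [set b | L (b * a)]; suff : maximal_left_ideal L' by apply: Jx.
have idL' : left_ideal L' := left_ideal_conductor (M := A^o) a idL.
split=> // [L'T|K idK L'K].
  by apply: La; rewrite -[a]mul1r -[L _]/(L' 1) L'T.
have [KL'|/existsNP[k /not_implyP[Kk Lka]]] := pselect (K `<=` L').
  by left; apply/seteqP.
right; apply/seteqP; split=> // r _.
(* [Q] is [L + A k a]. As [k * a] lies outside [L], maximality makes [Q] everything, so some
   [r - c * k] lies in [L'], hence in [K]. *)
pose Q := [set b | exists c, L (b - c * (k * a))].
have [QL|QT] : Q = L \/ Q = setT.
- apply: maxL; last by move=> b Lb; exists 0; rewrite mul0r subr0.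
  apply/left_idealP; split.
    by exists 0; rewrite mul0r subr0; apply: (submodule0 idL).
  move=> b u v [c Lc] [d Ld]; exists (b * c + d).
  have [_ linL] := (left_idealP L).1 idL.
  rewrite mulrDl -mulrA opprD addrACA -mulrBr; exact: linL.
- case: Lka; rewrite /L' /= -QL; exists 1.
  by rewrite mul1r subrr; apply: (submodule0 idL).
have [c Lc] : Q (r * a) by rewrite QT.
have Kd : K (r - c * k) by apply: L'K; rewrite /L' /= mulrBl -mulrA.
rewrite -(subrK (c * k) r); apply: (submoduleD idK Kd).
exact: (submoduleZ c idK Kk).
Qed.

(** The inverse is made two-sided so that elements of the radical are quasiregular in the opposite
    ring as well. *)
Lemma jacobson_radical_inverse x : jacobson_radical A x ->
  exists u, u * (1 - x) = 1 /\ (1 - x) * u = 1.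
Proof.
have idJ := ideal_jacobson_radical.
have linv y : jacobson_radical A y -> exists u, u * (1 - y) = 1.
  move=> Jy; apply: contrapT => noinv.
  pose N := [set a * (1 - y) | a in setT].
  have idN : left_ideal N.
    by apply: (@submodule_smul A A^o); apply: submodule_setT.
  have N1 : ~ N 1 by move=> [u _ uE]; apply: noinv; exists u.
  have [L [idL NL L1 maxL]] := maximal_submodule_avoiding idN N1.
  suff : L 1 by []; rewrite -(subrK y 1); apply: (submoduleD idL).
    by apply: NL; exists 1; rewrite ?mul1r.
  apply: Jy; split=> //.
    by move=> LT; apply: L1; rewrite LT.
  move=> K idK LK; have [K1|K1] := pselect (K 1); last first.
    by left; apply/seteqP; split=> //; apply: maxL.
  right; apply/seteqP; split=> // a _.
  by rewrite -[a]mulr1; apply: (submoduleZ a idK K1).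
move=> Jx; have [u uE] := linv _ Jx; exists u; split=> //.
(* [u] is itself [1 - y] with [y] in the radical, so besides the right inverse [1 - x] it has a left
   inverse, and the two agree. *)
have uE' : u = 1 - - (u * x) by rewrite opprK -uE mulrBr mulr1 subrK.
have [|v vE] := linv (- (u * x)).
  by rewrite -mulNr; apply: (idealMl _ idJ).
rewrite -uE' in vE.
by have := congr1 ( *%R v) uE; rewrite mulrA vE mul1r mulr1 => ->.
Qed.

Lemma nil_left_ideal_sub_jacobson_radical N :
  left_ideal N -> (forall x, N x -> exists n, x ^+ n = 0) ->
  N `<=` jacobson_radical A.
Proof.
move=> idN nilN x Nx L [idL LneT maxL]; apply: contrapT => Lx.
have [NL|NLT] : submodule_add (N : set A^o) L = L \/
    submodule_add (N : set A^o) L = setT.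
- apply: maxL; first exact: submodule_addP.
  exact: (@sub_submodule_addr A A^o).
- by apply: Lx; rewrite -NL; apply: (@sub_submodule_addl A A^o).
have [y [l [Ny Ll E]]] : exists y l : A, [/\ N y, L l & 1 = y + l].
  by have : submodule_add (N : set A^o) L 1 by rewrite NLT.
(* Modulo [L], [1] is congruent to [y], and left multiplication by [y] preserves [L]; a vanishing
   power of [y] then puts [1] in [L]. *)
have pow n : L (1 - y ^+ n).
  elim: n => [|n IHn]; first by rewrite expr0 subrr; apply: (submodule0 idL).
  have -> : 1 - y ^+ n.+1 = y * (1 - y ^+ n) + l.
    by rewrite mulrBr mulr1 -exprS addrAC -E.
  exact: (submoduleD idL (submoduleZ y idL (IHn : L _)) Ll).
have [n yn0] := nilN y Ny; have := pow n; rewrite yn0 subr0 => L1.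
apply: LneT; apply/seteqP; split=> // a _.
by rewrite -[a]mulr1; apply: (submoduleZ a idL L1).
Qed.

Lemma upper_nilradical_sub_jacobson_radical :
  upper_nilradical A `<=` jacobson_radical A.
Proof.
have [[[idN _] nilN] _] := upper_nilradical_largest A.
exact: nil_left_ideal_sub_jacobson_radical.
Qed.

(** For an ideal this is [N^n = 0], expressed on the products that span [N^n]; in this form it
    passes to the opposite ring by reversing lists. *)
Definition nilpotent_set N : Prop := exists n, forall s : seq A,
  size s = n -> [set` s] `<=` N -> \prod_(x <- s) x = 0.

Lemma nilpotent_set_nil N :
  nilpotent_set N -> forall x, N x -> exists n, x ^+ n = 0.
Proof.
move=> [n N0] x Nx; exists n; rewrite -(N0 (nseq n x)) ?size_nseq //.
  by rewrite big_nseq -Monoid.iteropE.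
by move=> y; rewrite /= mem_nseq => /andP[_ /eqP->].
Qed.

(* The powers of [N] stabilize at some [F n0]; were it nonzero, a left ideal
   minimal among those not killed by [F n0] would be [F n0 * x], containing [x]
   itself, so that [x = c * x] with [c] quasiregular. *)
Lemma left_artinian_quasiregular_nilpotent N : left_artinian A -> ideal N ->
    (forall x, N x -> exists u, u * (1 - x) = 1) ->
  nilpotent_set N.
Proof.
move=> artA idN qrN.
pose pow n := [set x | exists2 s : seq A,
  size s = n /\ [set` s] `<=` N & x = \prod_(y <- s) y].
(* The shift to [n.+1] factors keeps every product nonempty, which places [F n] inside [N]. *)
pose F n : set A := module_span (pow n.+1 : set A^o).
have idF n : left_ideal (F n) := submodule_span (pow n.+1 : set A^o).
have FN n : F n `<=` N.
  apply: (@span_sub A A^o); first by case: idN.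
  move=> _ [[|x s] [// _ sN] ->]; rewrite big_cons; case: idN => _; apply.
  by apply: sN; rewrite /= mem_head.
have [||n0 Fn0] := artA F.
- by move=> n; split; [exact: idF|].
- move=> n; apply: (@span_sub A A^o _ _ (idF n)) => _ [[|x s] [// [sz] sN] ->].
  rewrite big_cons; apply: (submoduleZ x (idF n)); apply: (@mem_span A A^o).
  by exists s => //; split=> // y ys; apply: sN; rewrite /= inE ys orbT.
(* [F n0] equals [F (n0 + n0.+1)], spanned by products of [2 (n0 + 1)] factors; each splits into two
   products of [n0.+1] factors, so [F n0] acts like its own square. *)
have FF x : (forall b c, F n0 b -> F n0 c -> b * c * x = 0) ->
    forall b, F n0 b -> b * x = 0.
  move=> bcx b; rewrite -(Fn0 (n0 + n0.+1)%N) ?leq_addr //; move: b.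
  apply: (@span_sub A A^o [set _ | _] [set b | b * x = 0]).
    apply/left_idealP; split; rewrite /= ?mul0r // => a u v ux vx.
    by rewrite mulrDl -mulrA ux vx mulr0 addr0.
  move=> _ [s [sz sN] ->] /=.
  rewrite -(cat_take_drop n0.+1 s) big_cat /=; apply: bcx.
    apply: (@mem_span A A^o); exists (take n0.+1 s) => //; split.
      by rewrite size_takel // sz ltnS leq_addr.
    by move=> y /mem_take /sN.
  apply: (@mem_span A A^o); exists (drop n0.+1 s) => //; split.
    by rewrite size_drop sz -addSn addKn.
  by move=> y /mem_drop /sN.
have [F0|] := pselect (F n0 `<=` [set 0]).
  exists n0.+1 => s sz sN; apply: F0.
  by apply: (@mem_span A A^o); exists s.
move=> /existsNP[f /not_implyP[Ff f0]]; exfalso.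
pose P := [set L | left_ideal L /\ exists b x, [/\ F n0 b, L x & b * x <> 0]].
have [||L [[idL [b [x [Fb Lx bx]]]] minL]] :=
    left_artinian_minimal (P := P) artA.
- by move=> L [].
- exists setT; split; first exact: submodule_setT.
  by exists f, 1; rewrite mulr1.
have FxL : [set c * x | c in F n0] `<=` L.
  by move=> _ [c _ <-]; apply: (submoduleZ c idL).
have : [set c * x | c in F n0] x.
  rewrite (minL [set c * x | c in F n0]) //; split.
    exact: (@submodule_smul A A^o).
  apply: contrapT => noL; apply: bx; apply: FF Fb => c d Fc Fd.
  apply: contrapT => cdx; apply: noL; exists c, (d * x).
  by rewrite mulrA; split=> //; exists d.
move=> [c Fc cx]; have [u uE] := qrN c (FN _ _ Fc).
by apply: bx; rewrite -[x]mul1r -uE -mulrA mulrBl mul1r cx subrr !mulr0.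
Qed.

End JacobsonRadical.

Lemma nilpotent_set_converse (A : pzRingType) (N : set A) :
  nilpotent_set (N : set A^c) -> nilpotent_set N.
Proof.
move=> [n N0]; exists n => s sz sN; rewrite -(revK s) -rev_prodr.
by apply: N0; rewrite ?size_rev // => x; rewrite /= mem_rev; apply: sN.
Qed.

(** In the right Artinian case the same set is an ideal of [A^c], quasiregular there thanks to the
    two-sided inverses. *)
Lemma jacobson_radical_nilpotent (A : pzRingType) :
  one_sided_artinian A -> nilpotent_set (jacobson_radical A).
Proof.
have idJ := @ideal_jacobson_radical A.
move=> [artA|artA].
  apply: left_artinian_quasiregular_nilpotent => // x.
  by move=> /jacobson_radical_inverse[u []]; exists u.
apply: nilpotent_set_converse; apply: left_artinian_quasiregular_nilpotent => //.
  split; last by move=> x a Jx; apply: (idealMl _ idJ).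
  apply/left_idealP; split; first exact: ideal0 idJ.
  move=> a u v Ju Jv; apply: (idealD idJ) => //.
  by case: idJ => _; apply.
by move=> x /jacobson_radical_inverse[u [_ uE]]; exists u.
Qed.

(** * Chain condition and radicals under surjective ring maps *)

Section Surjections.
Context {A B : pzRingType} (f : A -> B).
Hypotheses (fB : {morph f : x y / x - y}) (fM : {morph f : x y / x * y}).
Hypothesis f_surj : forall b, exists a, f a = b.

Let f0 : f 0 = 0.
Proof. by rewrite -(subrr 0) fB subrr. Qed.

Let fD x y : f (x + y) = f x + f y.
Proof. by rewrite -{1}[y]opprK -[- y]sub0r fB fB f0 sub0r opprK. Qed.

Lemma left_ideal_preimage (L : set B) : left_ideal L -> left_ideal (f @^-1` L).
Proof.
move=> /left_idealP[L0 linL]; apply/left_idealP; split; rewrite /= ?f0 //.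
by move=> a u v Lu Lv; rewrite /preimage /= fD fM; apply: linL.
Qed.

Lemma left_ideal_image (L : set A) : left_ideal L -> left_ideal (f @` L).
Proof.
move=> /left_idealP[L0 linL]; apply/left_idealP; split; first by exists 0.
move=> b _ _ [u Lu <-] [v Lv <-]; have [a <-] := f_surj b.
by exists (a * u + v); [apply: linL|rewrite fD fM].
Qed.

Lemma left_artinian_surjection : left_artinian A -> left_artinian B.
Proof.
move=> artA F idF decF; have [||n0 Fn0] := artA (fun n => f @^-1` (F n)).
- by move=> n; split=> //; apply: left_ideal_preimage; case: (idF n).
- by move=> n x /decF.
exists n0 => n /Fn0 FE; apply/seteqP; split=> b Fb; have [a ab] := f_surj b.
  have : (f @^-1` (F n)) a by rewrite /preimage /= ab.
  by rewrite FE /preimage /= ab.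
have : (f @^-1` (F n0)) a by rewrite /preimage /= ab.
by rewrite -FE /preimage /= ab.
Qed.

(** Preimages of maximal left ideals are maximal: a left ideal [K] above such a preimage contains
    the kernel, so it is recovered from its image. *)
Lemma jacobson_radical_surjection x :
  jacobson_radical A x -> jacobson_radical B (f x).
Proof.
move=> Jx L [idL LneT maxL]; suff : maximal_left_ideal (f @^-1` L) by apply: Jx.
split; first exact: left_ideal_preimage.
  move=> LT; apply: LneT; apply/seteqP; split=> // b _.
  have [a <-] := f_surj b.
  by have : [set: A] a by []; rewrite -LT.
move=> K idK LK; have preK : f @^-1` (f @` K) = K.
  apply/seteqP; split=> [a [k Kk ka]|a Ka]; last by exists a.
  rewrite -(subrK k a); apply: (submoduleD idK) => //; apply: LK.
  by rewrite /preimage /= fB ka subrr; apply: (submodule0 idL).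
have [|KL|KT] := maxL _ (left_ideal_image idK).
- move=> b Lb; have [a ab] := f_surj b; exists a => //.
  by apply: LK; rewrite /preimage /= ab.
- by left; rewrite -preK KL.
- by right; rewrite -preK KT.
Qed.

Lemma upper_nilradical_surjection x :
  upper_nilradical A x -> upper_nilradical B (f x).
Proof.
move=> [I [[idI rI] nilI] Ix]; exists (f @` I); last by exists x.
split; first split; first exact: left_ideal_image.
  move=> _ b [a Ia <-]; have [c <-] := f_surj b.
  by exists (a * c); rewrite ?fM //; apply: rI.
(* The exponent is kept positive because [f] is only known to respect differences and products, not
   [1]. *)
move=> _ [a /nilI[n an0] <-]; exists n.+1.
have -> : f a ^+ n.+1 = f (a ^+ n.+1).
  by elim: n {an0} => // n IHn; rewrite exprS IHn -fM -exprS.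
by rewrite exprS an0 mulr0.
Qed.

End Surjections.

(** * Nilpotent sets acting on a minimal bimodule *)

Definition additive_set (V : zmodType) (X : set V) : Prop :=
  X 0 /\ forall x y, X x -> X y -> X (x - y).

Lemma ideal_additive (T : pzRingType) (I : set T) : ideal I -> additive_set I.
Proof.
move=> [idI _]; split; first exact: (submodule0 idI).
by move=> x y; apply: (submoduleB idI).
Qed.

(** Closure of [K] under products, with the two bimodule conditions, is what makes [S + K] a subring
    when [S] is one. The conditions as a whole are unchanged in the opposite ring. *)
Definition minimal_bimodule (T : pzRingType) (S I : set T) : Prop :=
  forall K : set T, additive_set K -> K `<=` I ->
    (forall s x, S s -> K x -> K (s * x)) ->
    (forall s x, S s -> K x -> K (x * s)) ->
    (forall x y, K x -> K y -> K (x * y)) ->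
  K `<=` [set 0] \/ I `<=` K.

(** The additive group [K] spanned by [N I] is a sub-bimodule of [I], hence [0] or all of [I]; in
    the latter case [I = N I = N N I = ...] ends in [0]. *)
Lemma nilpotent_annihilates_left (T : pzRingType) (S I N : set T) :
    minimal_bimodule S I -> ideal I -> (forall s x, S s -> N x -> N (s * x)) ->
    nilpotent_set N ->
  forall x i, N x -> I i -> x * i = 0.
Proof.
move=> minI idI SN [n Nn].
have [I0 IB] := ideal_additive idI; have [_ rI] := idI.
pose G := [set z : T | exists x i, [/\ N x, I i & z = x * i]].
pose K := smallest (@additive_set T) G.
have GK : G `<=` K by exact: sub_gen_smallest.
have Kmin (X : set T) : additive_set X -> G `<=` X -> K `<=` X.
  exact: smallest_sub.
have [K0 KB] : additive_set K.
  split=> [X [[]] //|x y Kx Ky X [aX GX]].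
  by apply: aX.2; [apply: Kx|apply: Ky].
have KI : K `<=` I.
  by apply: Kmin => // _ [x [i [_ Ii ->]]]; apply: (idealMl x idI).
(* One argument serves both right multiplication by [S] and closure of [K] under products, as [K]
   lies in [I]. *)
have KM y k : I y \/ S y -> K k -> K (k * y).
  move=> Iy; move: k; apply: (Kmin [set k | K (k * y)]).
    by split=> [|u v Ku Kv] /=; rewrite ?mul0r // mulrBl; apply: KB.
  move=> _ [x [i [Nx Ii ->]]]; apply: GK; exists x, (i * y); rewrite -mulrA.
  by split=> //; apply: rI.
have [|||||K00|IK] := minI K.
- by [].
- exact: KI.
- move=> s k Ss; move: k; apply: (Kmin [set k | K (s * k)]).
    by split=> [|u v Ku Kv] /=; rewrite ?mulr0 // mulrBr; apply: KB.
  move=> _ [x [i [Nx Ii ->]]]; apply: GK; exists (s * x), i; rewrite mulrA.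
  by split=> //; apply: SN.
- by move=> s k Ss; apply: KM; right.
- by move=> x y Kx Ky; apply: KM => //; left; apply: KI.
- by move=> x i Nx Ii; apply: K00; apply: GK; exists x, i.
suff I00 : I `<=` [set 0] by move=> x i _ /I00 ->; rewrite mulr0.
have : forall s : seq T, size s = n -> [set` s] `<=` N ->
    forall i, I i -> \prod_(x <- s) x * i = 0.
  by move=> s sz sN i _; rewrite Nn ?mul0r.
(* [I] is spanned by [N I], hence a power of [N] killing [I] can be lowered. *)
elim: n {Nn} => [Nn i Ii|n IHn Nn].
  by have : \prod_(x <- [::]) x * i = 0; [apply: Nn|rewrite big_nil mul1r].
apply: IHn => s sz sN i /IK.
apply: (Kmin [set k | \prod_(x <- s) x * k = 0]) i.
  split=> [|u v Ku Kv] /=; first by rewrite mulr0.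
  by rewrite mulrBr Ku Kv subrr.
move=> _ [x [i [Nx Ii ->]]] /=; rewrite mulrA.
have := Nn (rcons s x); rewrite -cats1 big_cat big_seq1 /=; apply=> //.
  by rewrite size_cat sz addn1.
by move=> y; rewrite /= mem_cat mem_seq1 => /orP[/sN|/eqP->].
Qed.

Lemma nilpotent_annihilates_right (T : pzRingType) (S I N : set T) :
    minimal_bimodule S I -> ideal I -> (forall s x, S s -> N x -> N (x * s)) ->
    nilpotent_set N ->
  forall x i, N x -> I i -> i * x = 0.
Proof.
move=> minI idI NS nilN.
apply: (@nilpotent_annihilates_left T^c S I N) => //.
- by move=> K aK KI SK KS KK; apply: minI => // x y Kx Ky; apply: (KK y x).
- have [I0 IB] := ideal_additive idI; have [_ rI] := idI.
  split; last by move=> x a Ix; exact: (@idealMl T I a x).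
  apply/left_idealP; split=> // a u v Iu Iv.
  by apply: (@idealD T) => //; exact: (rI u a).
- exact: (@nilpotent_set_converse T^c).
Qed.

(** * The decomposition [T = S + I] and its retraction *)

Section MaximalSubring.
Variables (T : pzRingType) (S : {pred T}) (R : subPzRingType S) (I : set T).
Hypotheses (maxS : maximal_subring S) (idI : ideal I) (In0 : I <> [set 0]).
Hypothesis SI0 : [set` S] `&` I = [set 0].

Local Notation v := (\val : R -> T).

Lemma S_I_eq0 x : x \in S -> I x -> x = 0.
Proof. by move=> Sx Ix; have : ([set` S] `&` I) x by []; rewrite SI0. Qed.

(** The set [S + K] is a subring containing [S]. Were it equal to [S], a nonzero element of [K]
    would lie in both [S] and [I]; so it is all of [T]. *)
Lemma maximal_subring_add (K : set T) : additive_set K -> K `<=` I ->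
    (forall s x, s \in S -> K x -> K (s * x)) ->
    (forall s x, s \in S -> K x -> K (x * s)) ->
    (forall x y, K x -> K y -> K (x * y)) -> ~ (K `<=` [set 0]) ->
  forall t, exists s k, [/\ s \in S, K k & t = s + k].
Proof.
move=> [K0 KB] KI SK KS KK Kn0.
have [[S1 SB SM] _ maxQ] := maxS.
have S0 : 0 \in S by rewrite -(subrr 1) SB.
have KD x y : K x -> K y -> K (x + y).
  by move=> Kx Ky; rewrite -[y]opprK -[- y]sub0r; apply: (KB) => //; apply: KB.
pose Q : {pred T} := [pred t | `[< exists s k, [/\ s \in S, K k & t = s + k] >]].
have [||QS|QT] := maxQ Q.
- split.
  + by apply/asboolP; exists 1, 0; rewrite addr0.
  + move=> x y /asboolP[s [k [Ss Kk ->]]] /asboolP[s' [k' [Ss' Kk' ->]]].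
    apply/asboolP; exists (s - s'), (k - k').
    by rewrite opprD addrACA; split; [exact: SB|exact: KB|].
  + move=> x y /asboolP[s [k [Ss Kk ->]]] /asboolP[s' [k' [Ss' Kk' ->]]].
    apply/asboolP; exists (s * s'), (s * k' + k * s' + k * k').
    split; first exact: SM.
      by apply: (KD); [apply: KD; [exact: SK|exact: KS]|exact: KK].
    by rewrite mulrDl !mulrDr !addrA.
- by move=> s Ss; apply/asboolP; exists s, 0; rewrite addr0.
- case: Kn0 => k Kk; apply: S_I_eq0; last exact: KI.
  by rewrite -QS; apply/asboolP; exists 0, k; rewrite add0r.
- by move=> t; have /asboolP : t \in Q by rewrite QT.
Qed.

Lemma subring_add_ideal t : exists s k, [/\ s \in S, I k & t = s + k].
Proof.
have [_ rI] := idI; apply: maximal_subring_add t => //.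
- exact: ideal_additive.
- by move=> s x _; apply: (idealMl s idI).
- by move=> s x _; apply: rI.
- by move=> x y Ix; apply: (idealMl x idI).
- by move=> I0; apply: In0; apply/seteqP; split=> // _ ->; apply: ideal0.
Qed.

(** Once [T = S + K], an element [i = s + k] of [I] has [s = i - k] in both [S] and [I], hence
    [s = 0]. *)
Lemma ideal_minimal_bimodule : minimal_bimodule [set` S] I.
Proof.
move=> K aK KI SK KS KK; have [K0|Kn0] := pselect (K `<=` [set 0]); first by left.
right=> i Ii; have [s [k [Ss Kk iE]]] := maximal_subring_add aK KI SK KS KK Kn0 i.
suff s0 : s = 0 by rewrite iE s0 add0r.
apply: S_I_eq0 => //; have -> : s = i - k by rewrite iE addrK.
by apply: (ideal_additive idI).2 => //; apply: KI.
Qed.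

(** This is the projection along [I]: [f t] is the only element of [R] congruent to [t] modulo [I],
    so each law reduces to a congruence. *)
Lemma retraction : exists f : T -> R,
  [/\ {morph f : x y / x - y}, {morph f : x y / x * y} & cancel v f].
Proof.
have exR t : exists r : R, I (t - v r).
  have [s [k [Ss Ik ->]]] := subring_add_ideal t.
  by exists (Sub s Ss); rewrite SubK addrC addKr.
have [f fI] := choice exR.
have [_ IB] := ideal_additive idI.
have f_unique t r : I (t - v r) -> f t = r.
  move=> Ir; apply: val_inj; apply/eqP; rewrite -subr_eq0; apply/eqP.
  apply: S_I_eq0; first by rewrite -rmorphB; apply: valP.
  have -> : v (f t) - v r = (t - v r) - (t - v (f t)).
    by rewrite opprB [RHS]addrC -addrA addKr.
  exact: IB.
exists f; split=> [x y|x y|r].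
- apply: f_unique; rewrite rmorphB.
  have -> : x - y - (v (f x) - v (f y)) = (x - v (f x)) - (y - v (f y)).
    by rewrite !opprD addrACA.
  exact: IB.
- apply: f_unique; rewrite rmorphM.
  have -> : x * y - v (f x) * v (f y) =
      (x - v (f x)) * y + v (f x) * (y - v (f y)).
    by rewrite mulrBl mulrBr addrA subrK.
  apply: (idealD idI); last exact: (idealMl _ idI).
  by case: idI => _; apply.
- by apply: f_unique; rewrite subrr; apply: ideal0.
Qed.

Lemma retraction_one_sided_artinian :
  one_sided_artinian T -> one_sided_artinian R.
Proof.
have [f [fB fM fK]] := retraction.
have f_surj r : exists t, f t = r by exists (v r).
move=> [artT|artT]; [left|right]; first exact: left_artinian_surjection artT.
by apply: (@left_artinian_surjection T^c R^c f) => // x y; apply: fM.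
Qed.

(** * The image of [J(R)] in [T], and the comparison of radicals *)

Let N : set T := v @` jacobson_radical R.

Lemma radical_image_nilpotent : one_sided_artinian R -> nilpotent_set N.
Proof.
move=> /jacobson_radical_nilpotent[n Jn]; exists n => s sz sN.
have [f [fB fM fK]] := retraction.
have sE : s = [seq v (f x) | x <- s].
  rewrite -[LHS]map_id; apply/eq_in_map => x /sN[r _ <-].
  by rewrite fK.
rewrite sE big_map -(big_map f xpredT v) -rmorph_prod Jn ?rmorph0 ?size_map //.
by move=> _ /mapP[x /sN[r Jr <-] ->]; rewrite fK.
Qed.

Lemma radical_image_mul x s :
  s \in S -> N x -> N (s * x) /\ N (x * s).
Proof.
move=> Ss [r Jr <-]; have idJ := @ideal_jacobson_radical R.
rewrite -(SubK R Ss); split.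
  by exists (Sub s Ss * r); rewrite ?rmorphM //; apply: (idealMl _ idJ).
by exists (r * Sub s Ss); rewrite ?rmorphM //; case: idJ => _; apply.
Qed.

Lemma radical_image_annihilates : one_sided_artinian R ->
  forall x i, N x -> I i -> x * i = 0 /\ i * x = 0.
Proof.
move=> /radical_image_nilpotent nilN x i Nx Ii; split.
  apply: (nilpotent_annihilates_left ideal_minimal_bimodule idI _ nilN) => //.
  by move=> s y Ss Ny; have [] := radical_image_mul Ss Ny.
apply: (nilpotent_annihilates_right ideal_minimal_bimodule idI _ nilN) => //.
by move=> s y Ss Ny; have [] := radical_image_mul Ss Ny.
Qed.

(** Multiplying by [a = s + i], the factor [i] contributes [0] by annihilation and [s] acts inside
    [J(R)]. *)
Lemma radical_image_nil_ideal : one_sided_artinian R -> nil_ideal N.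
Proof.
move=> artR; have nilN := radical_image_nilpotent artR.
split; last exact: nilpotent_set_nil.
have [J0 JD] : N 0 /\ forall x y, N x -> N y -> N (x + y).
  have idJ := @ideal_jacobson_radical R; split.
    by exists 0; rewrite ?rmorph0 //; apply: ideal0 idJ.
  move=> _ _ [r Jr <-] [r' Jr' <-].
  by exists (r + r'); rewrite ?rmorphD //; apply: (idealD idJ).
split.
  apply/left_idealP; split=> // a x y Nx Ny; apply: JD => //.
  have [s [i [Ss Ii ->]]] := subring_add_ideal a; rewrite mulrDl.
  rewrite (radical_image_annihilates artR Nx Ii).2 addr0.
  by have [] := radical_image_mul Ss Nx.
move=> x a Nx; have [s [i [Ss Ii ->]]] := subring_add_ideal a; rewrite mulrDr.
rewrite (radical_image_annihilates artR Nx Ii).1 addr0.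
by have [] := radical_image_mul Ss Nx.
Qed.

(** Going up, both radicals of [R] land in the nil ideal [N]; going down, the surjection [f] carries
    radicals into radicals and inverts the embedding on [S]. *)
Lemma radicals_restrict : one_sided_artinian R ->
  N = jacobson_radical T `&` [set` S] /\
  v @` upper_nilradical R = upper_nilradical T `&` [set` S].
Proof.
move=> /radical_image_nil_ideal nilN.
have [f [fB fM fK]] := retraction.
have f_surj r : exists t, f t = r by exists (v r).
have NT : N `<=` upper_nilradical T.
  by have [_] := upper_nilradical_largest T; apply.
split; apply/seteqP; split.
- move=> x Nx; split; last by case: Nx => r _ <-; apply: valP.
  exact: upper_nilradical_sub_jacobson_radical (NT x Nx).
- move=> x [Jx Sx]; exists (Sub x Sx); last by rewrite SubK.
  rewrite -[Sub x Sx]fK SubK.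
  exact: (jacobson_radical_surjection fB fM f_surj).
- move=> _ [r nr <-]; split; last exact: valP.
  apply: NT; exists r => //.
  exact: upper_nilradical_sub_jacobson_radical.
- move=> x [nx Sx]; exists (Sub x Sx); last by rewrite SubK.
  rewrite -[Sub x Sx]fK SubK.
  exact: (upper_nilradical_surjection fB fM f_surj).
Qed.

(** * The ideal [I] as a left module over [R] *)

Let IR : set (restrict_scalars R) := I.

Lemma submodule_ideal_restrict : submodule IR.
Proof.
apply/submoduleP; split; first exact: ideal0 idI.
move=> a x y Ix Iy; apply: (idealD idI) => //.
exact: (idealMl _ idI).
Qed.

Lemma radical_annihilates_ideal : left_artinian R ->
  forall (a : R) (x : restrict_scalars R),
    jacobson_radical R a -> IR x -> a *: x = 0.
Proof.
move=> artR a x Ja Ix; rewrite restrict_scaleE.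
by case: (@radical_image_annihilates (or_introl artR) (v a) x) => //; exists a.
Qed.

(** If [T] is Artinian over [R], so is its submodule [I], which [J(R)] kills. Conversely
    [T = R 1 + I], so adding [1] to generators of [I] generates [T] over the Artinian ring [R]. *)
Lemma restrict_artinian_iff : left_artinian R ->
  artinian_module [set: restrict_scalars R] <-> finitely_generated IR.
Proof.
move=> artR; have sI := submodule_ideal_restrict; split=> [artT|[s IE]].
  apply: (finitely_generated_radical_annihilated artR) => //.
    exact: radical_annihilates_ideal.
  exact: artinian_sub artT.
have -> : [set: restrict_scalars R] =
    module_span [set` (1 : T) :: s : seq (restrict_scalars R)].
  apply/seteqP; split=> // t _; rewrite span_cons -IE.
  have [x [i [Sx Ii ->]]] := subring_add_ideal t.
  exists x, i; split=> //; exists (Sub x Sx) => //.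
  by rewrite restrict_scaleE SubK mulr1.
exact: artinian_span.
Qed.

End MaximalSubring.

Theorem proposition3p15 (T : pzRingType) (S : {pred T}) (R : subPzRingType S)
    (I : set T) :
  maximal_subring S -> ideal I -> I <> [set 0] -> [set` S] `&` I = [set 0] ->
  (one_sided_artinian R \/ one_sided_artinian T ->
     (\val : R -> T) @` jacobson_radical R = jacobson_radical T `&` [set` S] /\
     (\val : R -> T) @` upper_nilradical R = upper_nilradical T `&` [set` S]) /\
  (left_artinian R ->
     socle (I : set (restrict_scalars R)) = I /\
     (artinian_module [set: restrict_scalars R] <->
      finitely_generated (I : set (restrict_scalars R)))).
Proof.
move=> maxS idI In0 SI0; split=> [artRT|artR].
  apply: (radicals_restrict maxS idI In0 SI0).
  (* The Artinian condition on [T] descends to [R] along the retraction, on the same side. *)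
  by case: artRT => // /(retraction_one_sided_artinian R maxS idI In0 SI0).
split; last exact: (restrict_artinian_iff maxS idI In0 SI0).
apply: (socle_radical_annihilated artR).
  exact: submodule_ideal_restrict.
exact: (radical_annihilates_ideal maxS idI In0 SI0).
Qed.
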